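(* Let $G=\{x_0,x_1,\dots,x_{n-1}\}$ be a finite abelian group of order $n$ with neutral element $x_0$, let $\widetilde M_G$ be its extended Cayley table, and let $R$ be the regular representation of $G$ over $\mathbb C$. Then the number of different monomials occurring in $\mathrm{per}(\widetilde M_G)$ equals $\dim(S^{n+1}R)^G$.
   Context: The group operation of $G$ is denoted $\dotplus$. The elements $x_0,\dots,x_{n-1}$ of $G$ are also regarded as independent variables of the polynomial ring $\mathbb C[x_0,\dots,x_{n-1}]$. Put $x_n:=x_0$ (the neutral element taken a second time). The extended Cayley table is the $(n+1)\times(n+1)$ matrix $\widetilde M_G=(m_{i,j})_{0\le i,j\le n}$ with $m_{i,j}=x_i\dotplus x_j$, i.e. the variable corresponding to the group element $x_i\dotplus x_j$. Its permanent is $\mathrm{per}(\widetilde M_G)=\sum_{\pi}\prod_{i=0}^{n}m_{i,\pi(i)}$, the sum over all permutations $\pi$ of $\{0,1,\dots,n\}$. A monomial occurs in a polynomial if its coefficient is nonzero. $S^{n+1}R$ is the $(n+1)$-st symmetric power of $R$ and $(S^{n+1}R)^G$ its subspace of $G$-invariants. *)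

(* Defs.v *)
From HB Require Import structures.
From mathcomp Require Import all_boot all_order all_fingroup all_algebra.
From mathcomp Require Import mxrepresentation complex reals mpoly.

Set Implicit Arguments.
Unset Strict Implicit.
Unset Printing Implicit Defensive.

Import GroupScope GRing.Theory.
Local Open Scope ring_scope.

Definition permanent (A : comNzRingType) (n : nat) (M : 'M[A]_n) : A :=
  \sum_(s : 'S_n) \prod_(i < n) M i (s i).

Section ExtendedCayleyTable.

Variables (C : comNzRingType) (gT : finGroupType) (G : {group gT}).

(* The variables of {mpoly C[#|G|]} are the elements of G: a \in G is the      *)
(* variable whose index is gring_index G a, the index of a in the basis of the *)
(* regular representation.                                                     *)
Definition gvar (a : gT) : {mpoly C[#|G|]} := 'X_(gring_index G a).

(* x_0, ..., x_(n-1), x_n with x_n := x_0; the default value 1 of nth is never *)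
(* used when n > 0.                                                            *)
Definition ext_enum (n : nat) (x : n.-tuple gT) : n.+1.-tuple gT :=
  [tuple of rcons x (nth 1%g x 0)].

Definition ext_cayley (n : nat) (x : n.-tuple gT) :
    'M[{mpoly C[#|G|]}]_n.+1 :=
  \matrix_(i, j) gvar (tnth (ext_enum x) i * tnth (ext_enum x) j)%g.

End ExtendedCayleyTable.

(* The k-th symmetric power of the vector space F^m: homogeneous polynomials   *)
(* of degree k in the vectors 'X_0, ..., 'X_(m-1) of the standard basis.       *)
(* mpoly.v makes dhomog a vectType only for m of the form _.+1, whereas        *)
(* #|G| is not of this form; hence the alias and the instance below.           *)
Definition sympow (F : fieldType) (m k : nat) : Type := dhomog m F k.

Section SymmetricPower.

Variables (F : fieldType) (m k : nat).

HB.instance Definition _ := GRing.Lmodule.on (sympow F m k).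

Let mon : finType := {u : 'X_{1..m < k.+1} | mdeg u == k}.

Lemma sympow_vecaxiom : Vector.axiom #|mon| (sympow F m k).
Proof.
pose f (p : sympow F m k) : 'rV[F]_#|mon| :=
  \row_i (mpoly_of_dhomog p)@_(val (val (enum_val i))).
exists f; first by move=> c p q; apply/rowP=> i; rewrite !mxE /= mcoeffD mcoeffZ.
pose g (r : 'rV[F]_#|mon|) : {mpoly F[m]} :=
  \sum_(i < #|mon|) r 0 i *: 'X_[val (val (enum_val i))].
have gP r : g r \is k.-homog.
  rewrite rpred_sum //= => i _; apply/rpredZ.
  by rewrite dhomogX; exact: (valP (enum_val i)).
have gE r i : (g r)@_(val (val (enum_val i))) = r 0 i.
  rewrite /g raddf_sum /= (bigD1 i) //= mcoeffZ mcoeffX eqxx mulr1.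
  rewrite big1 ?addr0 // => j neq_ji.
  rewrite mcoeffZ mcoeffX (inj_eq val_inj) (inj_eq val_inj).
  by rewrite (inj_eq enum_val_inj) (negPf neq_ji) mulr0.
exists (fun r => DHomog (gP r)); last by move=> r; apply/rowP=> i; rewrite mxE /= gE.
move=> p; apply/val_inj/mpolyP=> u /=.
have [du | ndu] := eqVneq (mdeg u) k.
  have ltu : (mdeg u < k.+1)%N by rewrite du.
  have Pu : mdeg (BMultinom ltu) == k by rewrite /= du.
  have -> : u = val (val (enum_val (enum_rank (Sub (BMultinom ltu) Pu : mon)))).
    by rewrite enum_rankK.
  by rewrite gE mxE.
by rewrite (dhomog_nemf_coeff (gP _) ndu) (dhomog_nemf_coeff (valP p) ndu).
Qed.

HB.instance Definition _ :=
  Lmodule_hasFinDim.Build F (sympow F m k) sympow_vecaxiom.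

Variables (gT : finGroupType) (G : {group gT}) (rG : mx_representation F G m).

(* Representations act on row vectors, so g maps the i-th basis vector to the  *)
(* i-th row of rG g.                                                           *)
Definition sym_subst (g : gT) : m.-tuple {mpoly F[m]} :=
  [tuple \sum_(j < m) rG g i j *: 'X_j | i < m].

Lemma sym_act_homog (g : gT) (p : sympow F m k) :
  (mpoly_of_dhomog p) \mPo sym_subst g \is k.-homog.
Proof.
rewrite comp_mpolyEX big_seq rpred_sum // => u u_p; apply/rpredZ.
rewrite comp_mpolyX -(dhomog_mf (valP p) u_p) /= mdegE.
apply: (big_ind2 (fun (q : {mpoly F[m]}) d => q \is d.-homog)).
- exact: dhomog1.
- by move=> q d r e; apply: dhomogM.
move=> i _; rewrite tnth_mktuple -[X in X.-homog]mul1n; apply: dhomogMn.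
by rewrite rpred_sum // => j _; apply/rpredZ; rewrite dhomogX /= mdeg1.
Qed.

Definition sym_act (g : gT) (p : sympow F m k) : sympow F m k :=
  DHomog (sym_act_homog g p).

Lemma sym_act_is_linear (g : gT) : linear (sym_act g).
Proof. by move=> c p q; apply/val_inj; rewrite /= linearP. Qed.

HB.instance Definition _ (g : gT) :=
  GRing.isLinear.Build F (sympow F m k) (sympow F m k) _ (sym_act g)
    (sym_act_is_linear g).

Definition sym_invariants : {vspace sympow F m k} :=
  (\bigcap_(g in G) fixedSpace (linfun (sym_act g)))%VS.

End SymmetricPower.

Arguments sym_invariants {F m} k {gT G} rG.

(* Main.v *)
Require Import Defs.
From HB Require Import structures.
From mathcomp Require Import all_boot all_order all_fingroup all_algebra.
From mathcomp Require Import mxrepresentation complex reals mpoly.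
From mathcomp Require Import cyclic finmodule zify.

Set Implicit Arguments.
Unset Strict Implicit.
Unset Printing Implicit Defensive.

(* Write G additively and give a monomial the weight "sum of its variables".
   A monomial of the permanent is a multiset {x_i + x_pi(i)}; its weight is
   twice the sum of all elements of G, hence 0. Conversely, a multiset of n+1
   elements of weight 0 occurs in the permanent: replace two of its elements
   b, b' by b + b' and use M. Hall's theorem that every family (b_k) indexed by
   G with sum 0 is b_k = a_k + c_k for two permutations a, c of G. If
   b + b' = a_k + c_k, then after a translation b = a_k + 0 and b' = 0 + c_k,
   where 0 is the repeated element of the extended table. Nothing cancels in
   characteristic 0.
   On the other side, G acts on S^(n+1) R by translating monomials. Translation
   by v shifts the weight by (n+1) v = v, so every orbit of monomials is free
   and contains exactly one monomial of weight 0: an invariant is determined by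
   its coefficients at these monomials, and these coefficients are arbitrary. *)

Import GRing.Theory Num.Theory FiniteModule.

Local Open Scope ring_scope.

(** * Sums of two permutations of a finite abelian group *)

Lemma porbit_tperm_split (T : finType) (s : {perm T}) x y :
  x != y -> (x \in porbit (tperm x y * s)%g y) = (x \notin porbit s y).
Proof.
move=> neq_xy.
(* The cycle count formula is used twice, for [s] and for [tperm x y * s]; adding the two equations
   shows that exactly one of the two memberships holds. *)
have := porbits_mul_tperm s x y.
have := porbits_mul_tperm (tperm x y * s)%g x y.
rewrite /= mulgA tperm2 mul1g neq_xy.
case: (x \in porbit s y); case: (x \in porbit _ y) => //=; lia.
Qed.

Lemma perm_stable_restr (T : finType) (s : {perm T}) (A : {set T}) :
  (forall x, (s x \in A) = (x \in A)) ->
  exists t : {perm T}, forall x, t x = if x \in A then s x else x.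
Proof.
move=> sA; have injt : injective (fun x => if x \in A then s x else x).
  move=> x y; case: ifPn => Ax; case: ifPn => Ay //; first exact: perm_inj.
    by move=> eq_sx; rewrite -eq_sx sA Ax in Ay.
  by move=> eq_sy; rewrite eq_sy sA Ay in Ax.
by exists (perm injt) => x; rewrite permE.
Qed.

(* With D = a_p + a_q - b_q, moving a_p to row q requires the partner a_q - D.
   Chasing displaced partners gives the permutation tau, c_(tau k) = a_k - D.
   If p and q lie in distinct tau-cycles, shifting a backwards and c forwards
   along the cycle O of q preserves every sum a_k + c_k with k in O, k <> q, and
   exchanging the entries of a in rows p and q repairs both. Otherwise, first
   exchanging c_p and c_q splits the cycle. *)
Lemma perm_sum_exchange (V : finZmodType) (a c : {perm V}) (b : V -> V) p q :
    p != q -> (forall k, k != p -> k != q -> a k + c k = b k) ->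
    a p + a q + (c p + c q) = b p + b q ->
  exists a' c' : {perm V}, forall k, a' k + c' k = b k.
Proof.
move=> neq_pq ok_b sum_b; pose D := a p + a q - b q.
pose tau (c : {perm V}) := (a * perm (@addIr V (- D)) * c^-1)%g.
have tauE (c0 : {perm V}) k : c0 (tau c0 k) = a k - D.
  by rewrite !permM permKV permE.
wlog np_q : c ok_b sum_b / p \notin porbit (tau c) q.
  move=> IH; have [|] := boolP (p \in porbit (tau c) q); last exact: IH.
  move=> p_q; apply: (IH (tperm p q * c)%g) => [k kp kq||].
  - by rewrite permM tpermD ?ok_b // eq_sym.
  - by rewrite !permM tpermL tpermR [c q + c p]addrC.
  have -> : tau (tperm p q * c)%g = (tau c * tperm p q)%g.
    by rewrite /tau invMg tpermV mulgA.
  (* Inversion keeps the cycles and brings the transposition to the left, where [porbit_tperm_split]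
     expects it. *)
  rewrite -porbitV invMg tpermV porbit_tperm_split ?porbitV //.
  by rewrite p_q.
have [th thE] : exists t : {perm V}, forall k,
    t k = if k \in porbit (tau c) q then tau c k else k.
  apply: perm_stable_restr => k.
  by rewrite -!eq_porbit_mem -(porbit_perm _ 1 k) expg1.
have thV k : k \in porbit (tau c) q -> a (th^-1%g k) = c k + D.
  set r := th^-1%g k => Ok; have er : th r = k by rewrite permKV.
  have Or : r \in porbit (tau c) q.
    by move: er; rewrite thE; case: ifP => // nr er; rewrite -er nr in Ok.
  by rewrite -er thE Or tauE subrK.
have thO k : k \notin porbit (tau c) q -> th^-1%g k = k.
  by move=> nk; apply: (@perm_inj _ th); rewrite permKV thE (negPf nk).
have q_q := porbit_id (tau c) q.
exists (tperm p q * th^-1 * a)%g, (th * c)%g => k; rewrite !permM.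
have [->|kp] := eqVneq k p.
  rewrite tpermL thV // thE (negPf np_q).
  by rewrite addrAC addrC [c q + c p]addrC addrAC sum_b addrK.
have [->|kq] := eqVneq k q.
  rewrite tpermR thO // thE q_q tauE addrA [_ - D]addrC opprB addrC addrCA.
  by rewrite subrr addr0.
rewrite tpermD 1?eq_sym // -ok_b // thE; case: ifP => Ok.
  by rewrite thV // tauE addrC addrA addrAC subrK.
by rewrite thO // Ok.
Qed.

(* M. Hall, 1952. *)
Lemma perm_sum_target (V : finZmodType) (b : V -> V) :
  \sum_k b k = 0 -> exists a c : {perm V}, forall k, a k + c k = b k.
Proof.
have [n] := ubnP #|[set k | (k != 0) && (b k != 0)]|.
elim: n => // n IHn in b * => /ltnSE-le_n sum_b.
have [set_b | [p]] := set_0Vmem [set k | (k != 0) && (b k != 0)].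
  have b0 k : k != 0 -> b k = 0.
    move=> k0; apply/eqP/negPn/negP => bk0.
    by have := in_set0 k; rewrite -set_b inE k0 bk0.
  exists 1%g, (perm (@oppr_inj V)) => k; rewrite perm1 permE subrr.
  have [->|/b0-> //] := eqVneq k 0.
  by move: sum_b; rewrite (bigD1 0) //= big1 ?addr0.
rewrite inE => /andP[p0 bp0].
(* Merging the value at [p] into index 0 keeps the sum and lowers the number of nonzero values away
   from 0. Only rows [p] and 0 then need repair. *)
pose b1 k := if k == p then 0 else if k == 0 then b 0 + b p else b k.
have [||a [c acb]] := IHn b1.
- apply: leq_trans le_n; apply/proper_card/properP; split.
    apply/subsetP => k; rewrite !inE /b1.
    by case: ifP; rewrite ?eqxx ?andbF //; case: ifP.
  by exists p; rewrite ?inE ?p0 // /b1 eqxx eqxx andbF.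
- apply: etrans sum_b; rewrite (bigD1 p) //= [RHS](bigD1 p) //=.
  rewrite (bigD1 0) 1?eq_sym //=.
  rewrite [X in _ = _ + X](bigD1 0) 1?eq_sym //= /b1 eqxx eq_sym (negPf p0).
  rewrite add0r eqxx addrCA addrA; congr (_ + _).
  by apply: eq_bigr => k /andP[/negPf-> /negPf->].
apply: (@perm_sum_exchange _ a c _ p 0) => // [k kp k0|].
  by rewrite acb /b1 (negPf kp) (negPf k0).
by rewrite addrACA !acb /b1 eqxx eq_sym (negPf p0) eqxx add0r addrC.
Qed.

Lemma perm_eq_map_perm (T : finType) (s : {perm T}) :
  perm_eq [seq s x | x <- enum T] (enum T).
Proof.
apply: uniq_perm; rewrite ?(map_inj_uniq perm_inj) ?enum_uniq // => x.
rewrite mem_enum inE; apply/mapP; exists (s^-1%g x); rewrite ?permKV //.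
by rewrite mem_enum.
Qed.

(** [0 :: enum V] is the list of row labels, and of column labels, of the extended table. *)
Lemma perm_sum_target_ext (V : finZmodType) (s : seq V) :
    size s = #|V|.+1 -> \sum_(v <- s) v = 0 ->
  exists A C : seq V, [/\ perm_eq A (0 :: enum V), perm_eq C (0 :: enum V)
    & [seq u.1 + u.2 | u <- zip A C] = s].
Proof.
have : (0 < #|V|)%N by apply/card_gt0P; exists 0.
rewrite cardE; case defV: (enum V) => [//|k0 e] _.
case: s => [|s1 [|s2 s]] //= [size_s]; rewrite !big_cons addrA => sum_s.
have /andP[k0e uniq_e] : (k0 \notin e) && uniq e.
  by rewrite -cons_uniq -defV enum_uniq.
have [b [b0 be]] : exists b : V -> V, b k0 = s1 + s2 /\ map b e = s.
  exists (fun k => nth 0 (s1 + s2 :: s) (index k (k0 :: e))); split.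
    by rewrite /= eqxx.
  apply: (@eq_from_nth _ 0); rewrite size_map // => i lt_ie.
  rewrite (nth_map 0) //= ifN ?index_uniq //.
  by apply: contraNneq k0e => ->; rewrite mem_nth.
have [|a [c acb]] := @perm_sum_target V b.
  by apply: etrans sum_s; rewrite -big_enum defV big_cons b0 -be big_map.
(* This translation gives [a k0 + t = s1] and [c k0 - t = s2]; the extra zeros are placed so that
   these two values are each paired with 0. *)
pose t := s1 - a k0.
have perm_shift (f : {perm V}) (u : V) :
    perm_eq (f k0 + u :: [seq f k + u | k <- e]) (k0 :: e).
  have := perm_eq_map_perm (f * perm (@addIr V u))%g.
  rewrite defV /= permM permE (eq_map (g := fun k => f k + u)) // => k.
  by rewrite permM permE.
exists (a k0 + t :: 0 :: [seq a k + t | k <- e]).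
exists (0 :: c k0 - t :: [seq c k - t | k <- e]); split.
- rewrite -[_ :: 0 :: _]cat1s perm_catC -cat1s -catA perm_cons perm_catC.
  exact: perm_shift.
- by rewrite perm_cons; apply: perm_shift.
rewrite /= addr0 add0r -be /t addrC subrK; congr [:: _, _ & _].
  by rewrite opprB addrA [c k0 + _]addrC acb b0 addrC addKr.
elim: e {k0e uniq_e defV perm_shift be size_s} => //= k e ->.
by rewrite addrACA subrr addr0 acb.
Qed.

(** * Monomials of a permanent *)

(** The coefficient of [m] is the number of permutations that produce it, and a positive integer is
    nonzero in a [numDomainType]. *)
Lemma msupp_permanent_monomials (C : numDomainType) (k n : nat)
    (M : 'I_n -> 'I_n -> 'X_{1..k}) (m : 'X_{1..k}) :
  reflect (exists s : 'S_n, m = (\sum_i M i (s i))%MM)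
    (m \in msupp (permanent (\matrix_(i, j) ('X_[M i j] : {mpoly C[k]})))).
Proof.
rewrite mcoeff_msupp /permanent.
pose A : 'M[{mpoly C[k]}]_n := \matrix_(i, j) 'X_[M i j].
have -> : (\sum_(s : 'S_n) \prod_i A i (s i))@_m
    = #|[set s : 'S_n | (\sum_i M i (s i))%MM == m]|%:R.
  rewrite raddf_sum /= -sum1dep_card natr_sum [RHS]big_mkcond /=.
  apply: eq_bigr => s _.
  under eq_bigr do rewrite mxE.
  rewrite -(big_map (fun i => M i (s i)) xpredT (fun u => 'X_[u])) mpolyX_prod.
  by rewrite big_map mcoeffX; case: eqP.
rewrite pnatr_eq0 cards_eq0; apply: (iffP (set0Pn _)) => -[s].
  by rewrite inE => /eqP <-; exists s.
by move=> ->; exists s; rewrite inE.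
Qed.

(** * Weights and translations of monomials, with G written additively *)

Section Translation.

Variables (gT : finGroupType) (G : {group gT}) (abG : abelian G).

Local Notation V := (fmod_of abG).
Implicit Types (v w : V) (m : 'X_{1..#|G|}).

Definition var_elt (i : 'I_#|G|) : V := fmod abG (enum_val i).
Definition elt_var (v : V) : 'I_#|G| := gring_index G (fmval v).

Lemma var_eltK : cancel var_elt elt_var.
Proof. by move=> i; rewrite /elt_var fmodK ?enum_valP // gring_valK. Qed.

Lemma elt_varK : cancel elt_var var_elt.
Proof. by move=> v; rewrite /var_elt gring_indexK ?fmodP ?fmvalK. Qed.

Lemma card_fmod : #|{: V}| = #|G|.
Proof.
rewrite -[RHS]card_ord; apply/esym/bij_eq_card.
by exists elt_var; [apply: var_eltK | apply: elt_varK].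
Qed.

Definition weight (m : 'X_{1..#|G|}) : V := \sum_i var_elt i *+ m i.

Lemma weightD m1 m2 : weight (m1 + m2)%MM = weight m1 + weight m2.
Proof.
by rewrite /weight -big_split; apply: eq_bigr => i _; rewrite mnmDE mulrnDr.
Qed.

Lemma weightU v : weight U_(elt_var v)%MM = v.
Proof.
rewrite /weight (bigD1 (elt_var v)) //= mnm1E eqxx elt_varK.
rewrite big1 ?addr0 // => i nvi; by rewrite mnm1E eq_sym (negPf nvi).
Qed.

Lemma weight_sum (s : seq V) :
  weight (\sum_(v <- s) U_(elt_var v))%MM = \sum_(v <- s) v.
Proof.
elim: s => [|v s IHs]; last by rewrite !big_cons weightD weightU IHs.
by rewrite !big_nil /weight big1 // => i _; rewrite mnm0E.
Qed.

Lemma mnm_sum_elts (m : 'X_{1..#|G|}) :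
  exists2 s : seq V, size s = mdeg m & m = (\sum_(v <- s) U_(elt_var v))%MM.
Proof.
exists (map var_elt (m2s m)); first by rewrite size_map size_m2s.
rewrite big_map -{1}[m]s2mK; under eq_bigr do rewrite var_eltK.
elim: (m2s m) => [|i s IHs]; rewrite !(big_nil, big_cons).
  by apply/mnmP => j; rewrite !mnmE.
by rewrite -IHs; apply/mnmP => j; rewrite mnmDE mnm1E !mnmE /= eq_sym.
Qed.

Lemma msupp_permanent_ext_cayley (C : numDomainType) (n : nat) (x : n.-tuple gT)
    (m : 'X_{1..#|G|}) :
    #|G| = n -> x =i G -> nth 1%g x 0 = 1%g ->
  (m \in msupp (permanent (ext_cayley C G x)))
    = (mdeg m == n.+1) && (weight m == 0).
Proof.
move=> G_order G_enum x0.
pose y := map_tuple (fmod abG) (ext_enum x).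
have x_G i : tnth (ext_enum x) i \in G.
  have: tnth (ext_enum x) i \in ext_enum x by apply: mem_tnth.
  by rewrite mem_rcons inE x0 => /predU1P[->|]; rewrite ?group1 ?G_enum.
have y_enum : perm_eq y (0 :: enum {: V}).
  rewrite /= map_rcons perm_rcons x0 fmod1 perm_cons.
  have uniq_x : uniq x.
    apply/card_uniqP; rewrite size_tuple.
    by apply: etrans G_order; apply: eq_card.
  apply: uniq_perm; rewrite ?enum_uniq //.
    rewrite map_inj_in_uniq // => u v; rewrite !G_enum => Gu Gv.
    exact: (injmP (injm_fmod abG)).
  move=> v; rewrite mem_enum inE; apply/mapP; exists (fmval v).
    by rewrite G_enum fmodP.
  by rewrite fmvalK.
have -> : ext_cayley C G x =
    \matrix_(i, j) 'X_[U_(elt_var (tnth y i + tnth y j))].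
  apply/matrixP => i j; rewrite !mxE /gvar !tnth_map /elt_var fmvalA /=.
  by rewrite !fmodK.
have sum_y : \sum_i tnth y i = \sum_(v : V) v.
  rewrite -(big_tuple _ _ _ xpredT id) (perm_big _ y_enum) big_cons /=.
  by rewrite add0r big_enum.
apply/msupp_permanent_monomials/andP => [[s ->] | [/eqP deg_m /eqP weight_m]].
  rewrite -(big_map (fun i => tnth y i + tnth y (s i)) xpredT
    (fun v => U_(elt_var v)%MM)).
  split.
    rewrite mdeg_sum; under eq_bigr do rewrite mdeg1.
    by rewrite big_map sum1_card card_ord.
  have sum_ys : \sum_i tnth y (s i) = \sum_(v : V) v.
    by rewrite -sum_y [RHS](reindex_inj (@perm_inj _ s)).
  rewrite weight_sum big_map big_split /= sum_ys sum_y.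
  (* Replacing [v] by [- v] in one of the two sums makes them cancel termwise. *)
  rewrite [X in _ + X](reindex_inj (@oppr_inj V)) -big_split big1 // => v _.
  exact: subrr.
have [s size_s def_m] := mnm_sum_elts m.
have [||A [C' [A_y C_y def_s]]] := @perm_sum_target_ext (V : finZmodType) s.
- by rewrite size_s deg_m card_fmod G_order.
- by rewrite -weight_sum -def_m.
move: A_y C_y; rewrite perm_sym => A_y; rewrite perm_sym => C_y.
have /tuple_permP[p def_A] : perm_eq A y.
  by rewrite perm_sym (perm_trans y_enum).
have /tuple_permP[q def_C] : perm_eq C' y.
  by rewrite perm_sym (perm_trans y_enum).
(* The [i]-th terms of [A] and [C'] are the labels of row [p i] and column [q i], so the permutation
   must send [p i] to [q i]. *)
exists (p^-1 * q)%g.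
rewrite def_m -def_s def_A def_C /= zip_map -map_comp big_map big_enum /=.
rewrite [RHS](reindex_inj (@perm_inj _ p)) /=.
by apply: eq_bigr => i _; rewrite permM permK.
Qed.

Local Notation "m # s" := [multinom m (s i) | i < #|G|]
  (at level 40, left associativity, format "m # s").

Lemma shift_var_inj (v : V) : injective (fun i => elt_var (var_elt i + v)).
Proof.
by move=> i j /(can_inj (elt_varK))/addIr/(can_inj (var_eltK)).
Qed.

Definition shift_var (v : V) : 'S_#|G| := perm (@shift_var_inj v).

Lemma var_elt_shift v i : var_elt (shift_var v i) = var_elt i + v.
Proof. by rewrite permE elt_varK. Qed.

Lemma shift_varD v w : shift_var (v + w) = (shift_var v * shift_var w)%g.
Proof. by apply/permP => i; rewrite permM !permE elt_varK addrA. Qed.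

Lemma mperm_shift0 m : m#(shift_var 0) = m.
Proof. by apply/mnmP => i; rewrite mnmE permE addr0 var_eltK. Qed.

Lemma mperm_shiftD (m : 'X_{1..#|G|}) v w :
  (m#(shift_var w))#(shift_var v) = m#(shift_var (v + w)).
Proof. by apply/mnmP => i; rewrite !mnmE shift_varD permM. Qed.

(** The exponent of [i] in [m#(shift_var v)] is read at [i + v], so the variables of [m] are
    translated by [- v]. *)
Lemma weight_shift m v : weight (m#(shift_var v)) + v *+ mdeg m = weight m.
Proof.
rewrite [RHS](reindex_inj (@perm_inj _ (shift_var v))) /= mdegE -sumrMnr.
rewrite [X in _ + X = _](reindex_inj (@perm_inj _ (shift_var v))) -big_split /=.
by apply: eq_bigr => i _; rewrite mnmE var_elt_shift mulrnDl.
Qed.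

Lemma fmod_mulrn_cardS (v : V) : v *+ #|G|.+1 = v.
Proof.
rewrite mulrS (_ : v *+ _ = 0) ?addr0 //; apply: fmod_inj.
by rewrite fmvalZ expg_cardG ?fmodP.
Qed.

(** * Invariants of the symmetric powers of the regular representation *)

Section Field.

Variables (F : fieldType) (k : nat).

Local Notation rG := (regular_repr F G).

(** Each row of a regular representation matrix has a single entry 1, so the substitution only
    renames variables. *)
Lemma mcoeff_sym_act_regular (v : V) (p : sympow F #|G| k) m :
  (mpoly_of_dhomog (sym_act rG (fmval v) p))@_m
    = (mpoly_of_dhomog p)@_(m#(shift_var v)).
Proof.
rewrite -mcoeff_sym; congr (_@_m) => /=.
apply: eq_bigr => u _; congr (_ * _); apply: mmap1_eq => i.
rewrite tnth_mktuple permE /elt_var fmvalA fmodK ?enum_valP //.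
rewrite (bigD1 (gring_index G (enum_val i * fmval v)%g)) //= big1 => [|j nj].
  by rewrite mxE mxE !eqxx scale1r addr0.
by rewrite mxE mxE (negPf nj) andbF scale0r.
Qed.

Lemma sym_invariants_regularP (p : sympow F #|G| k) :
  reflect (forall v m, (mpoly_of_dhomog p)@_(m#(shift_var v))
                         = (mpoly_of_dhomog p)@_m)
    (p \in sym_invariants k rG).
Proof.
apply: (iffP idP) => [inv_p v m | inv_p].
  have /subv_bigcapP/(_ _ (fmodP v))/subvP/(_ p inv_p) :=
    subvv (sym_invariants k rG).
  by move/fixedSpaceP; rewrite lfunE -mcoeff_sym_act_regular => ->.
apply: (introT subv_bigcapP) => g Gg; apply/fixedSpaceP; rewrite lfunE.
apply/val_inj/mpolyP => m.
by rewrite -[g](fmodK abG) // mcoeff_sym_act_regular.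
Qed.

Lemma dim_sym_invariants_regular (s : seq 'X_{1..#|G|}) :
    k = #|G|.+1 -> uniq s ->
    (forall m, (m \in s) = (mdeg m == k) && (weight m == 0)) ->
  \dim (sym_invariants k rG) = size s.
Proof.
move=> def_k uniq_s mem_s.
pose f (p : sympow F #|G| k) : 'rV[F]_(size s) :=
  \row_i (mpoly_of_dhomog p)@_(nth 0%MM s i).
have f_lin : linear f.
  by move=> c p q; apply/rowP => i; rewrite !mxE mcoeffD mcoeffZ.
pose fL := GRing.isLinear.Build F _ _ _ f f_lin.
pose fl : {linear sympow F #|G| k -> 'rV[F]_(size s)} := HB.pack f fL.
have s_s (i : 'I_(size s)) :
    (mdeg (nth 0%MM s i) == k) && (weight (nth 0%MM s i) == 0).
  by rewrite -mem_s mem_nth.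
(* Each orbit meets [s]: translating [m] by minus its own weight [w] changes the weight by
   [- w *+ k = - w]. *)
have shift_s m : mdeg m = k -> m#(shift_var (weight m)) \in s.
  move=> deg_m; rewrite mem_s mdeg_mperm deg_m eqxx /=.
  rewrite -(inj_eq (addIr (weight m))) add0r -{2}[weight m]fmod_mulrn_cardS.
  by rewrite -def_k -deg_m weight_shift.
(* Injectivity of [f] on the invariants; surjectivity follows. *)
rewrite -(@limg_dim_eq _ _ _ (linfun fl)); last first.
  apply/eqP; rewrite -subv0; apply/subvP => p; rewrite memv_cap memv0 memv_ker.
  case/andP=> /sym_invariants_regularP inv_p /eqP; rewrite lfunE /= => /rowP f0.
  apply/eqP/val_inj/mpolyP => m; rewrite mcoeff0.
  have [/shift_s s_m | ndeg] := eqVneq (mdeg m) k; last first.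
    exact: dhomog_nemf_coeff (valP p) ndeg.
  rewrite -(inv_p (weight m)) -(nth_index 0%MM s_m).
  have lt_m : (index (m#(shift_var (weight m))) s < size s)%N.
    by rewrite index_mem.
  by have := f0 (Ordinal lt_m); rewrite !mxE.
suff -> : (linfun fl @: sym_invariants k rG)%VS = fullv.
  by rewrite dimvf dim_matrix; exact: mul1n.
apply/vspaceP => r; rewrite memvf; apply/memv_imgP.
pose q : {mpoly F[#|G|]} := \sum_(i < size s) r 0 i *: 'X_[nth 0%MM s i].
have q_homog : q \is k.-homog.
  rewrite rpred_sum // => i _; apply: rpredZ; rewrite dhomogX.
  by have /andP[] := s_s i.
have qE m : q@_m = \sum_(i < size s) r 0 i * (nth 0%MM s i == m)%:R.
  by rewrite raddf_sum; apply: eq_bigr => i _; rewrite /= mcoeffZ mcoeffX.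
have q_s (i : 'I_(size s)) : q@_(nth 0%MM s i) = r 0 i.
  rewrite qE (bigD1 i) //= eqxx mulr1 big1 ?addr0 // => j nij.
  by rewrite nth_uniq // (inj_eq val_inj) (negPf nij) mulr0.
have q_out m : m \notin s -> q@_m = 0.
  move=> s'm; rewrite qE big1 // => i _.
  case: eqP => [def_m|_]; last by rewrite mulr0.
  by rewrite -def_m mem_nth in s'm.
(* Summing all translates of [q] makes it invariant. The coefficients at [s] are unchanged, because
   a nonzero translation takes weight 0 to nonzero weight. *)
pose p : sympow F #|G| k := \sum_(v : V) sym_act rG (fmval v) (DHomog q_homog).
have pE m : (mpoly_of_dhomog p)@_m = \sum_(v : V) q@_(m#(shift_var v)).
  rewrite raddf_sum /= raddf_sum; apply: eq_bigr => v _.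
  exact: (mcoeff_sym_act_regular v (DHomog q_homog) m).
exists p.
  apply/sym_invariants_regularP => v m.
  rewrite !pE [RHS](reindex_inj (addIr v)) /=.
  by apply: eq_bigr => w _; rewrite mperm_shiftD.
apply/rowP => i; rewrite lfunE mxE pE (bigD1 0) //= big1 ?addr0 => [|v nz_v].
  by rewrite mperm_shift0 q_s.
apply: q_out; apply: contra nz_v; rewrite !mem_s => /andP[_ /eqP shift0].
have /andP[/eqP deg_i /eqP weight_i] := s_s i.
have := weight_shift (nth 0%MM s i) v.
by rewrite shift0 weight_i deg_i def_k fmod_mulrn_cardS add0r => ->.
Qed.

End Field.
End Translation.

Theorem corollary5p9 (R : realType) (gT : finGroupType) (G : {group gT})
    (n : nat) (x : n.-tuple gT)
    (G_abelian : abelian G) (G_order : #|G| = n)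
    (G_enum : x =i G) (x0_neutral : nth 1%g x 0 = 1%g) :
  size (msupp (permanent (ext_cayley R[i] G x))) =
  \dim (sym_invariants n.+1 (regular_repr R[i] G)).
Proof.
apply/esym/(dim_sym_invariants_regular (abG := G_abelian)) => [||m].
- by rewrite G_order.
- exact: msupp_uniq.
- exact: msupp_permanent_ext_cayley.
Qed.
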